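(* Let $(X,r)$ be a solution with $|X|=n$ finite and let $B=\mathcal{G}(X,r)$ be its permutation left brace. Suppose that $\lambda_a(a)=a$ for all $a\in B$. Then the Dehornoy's class of $(X,r)$ is bounded above by $g(n)$, where $g(n)$ is the maximum order of a permutation in $\mathrm{Sym}(n)$.
   Context: A solution is a pair $(X,r)$ with $X$ a non-empty set and $r:X\times X\to X\times X$, $r(x,y)=(\sigma_x(y),\tau_y(x))$, such that $(r\times \mathrm{id})(\mathrm{id}\times r)(r\times \mathrm{id})=(\mathrm{id}\times r)(r\times \mathrm{id})(\mathrm{id}\times r)$ on $X^3$, $r^2=\mathrm{id}$ (involutive), and all maps $\sigma_x,\tau_y:X\to X$ are bijections (non-degenerate). The permutation group $\mathcal{G}(X,r)$ is the subgroup of $\mathrm{Sym}(X)$ generated by all $\sigma_x$. A left brace is a set $B$ with two operations $+,\circ$ such that $(B,+)$ is an abelian group, $(B,\circ)$ is a group and $a\circ(b+c)=a\circ b-a+a\circ c$ for all $a,b,c$. Put $\lambda_a(b)=-a+a\circ b$. The permutation left brace of $(X,r)$ is $\mathcal{G}(X,r)$ with $\circ$ equal to composition and with the unique addition making it a left brace such that $\lambda_g(\sigma_x)=\sigma_{g(x)}$ for all $g\in\mathcal{G}(X,r)$, $x\in X$. Dehornoy's class: set $x\cdot y=\sigma_x^{-1}(y)$ and define $\Omega_m:X^m\to X$ by $\Omega_1(x_1)=x_1$ and $\Omega_m(x_1,\dots,x_m)=\Omega_{m-1}(x_1,\dots,x_{m-1})\cdot\Omega_{m-1}(x_1,\dots,x_{m-2},x_m)$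 for $m>1$. The Dehornoy's class of $(X,r)$ is the minimal positive integer $d$ such that $\Omega_{d+1}(x,x,\dots,x,y)=y$ for all $x,y\in X$. *)

(* Defs.v *)
From HB Require Import structures.
From mathcomp Require Import all_boot all_fingroup.

Set Implicit Arguments.
Unset Strict Implicit.
Unset Printing Implicit Defensive.

Section Solutions.
Variable X : Type.

Definition r_x_id (r : X * X -> X * X) (t : X * X * X) : X * X * X :=
  let: (x, y, z) := t in (r (x, y), z).

Definition id_x_r (r : X * X -> X * X) (t : X * X * X) : X * X * X :=
  let: (x, y, z) := t in (x, (r (y, z)).1, (r (y, z)).2).

Record solution := Solution {
  sol_map : X * X -> X * X;
  sol_inhabited : inhabited X;
  sol_braid : forall t : X * X * X,
    r_x_id sol_map (id_x_r sol_map (r_x_id sol_map t)) =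
    id_x_r sol_map (r_x_id sol_map (id_x_r sol_map t));
  sol_involutive : forall p : X * X, sol_map (sol_map p) = p;
  sol_sigma_bij : forall x, bijective (fun y => (sol_map (x, y)).1);
  sol_tau_bij : forall y, bijective (fun x => (sol_map (x, y)).2)
}.
End Solutions.

Record left_brace (B : Type) := LeftBrace {
  badd : B -> B -> B;
  bzero : B;
  bopp : B -> B;
  bcirc : B -> B -> B;
  bone : B;
  binv : B -> B;
  baddA : associative badd;
  baddC : commutative badd;
  badd0 : left_id bzero badd;
  baddN : left_inverse bzero bopp badd;
  bcircA : associative bcirc;
  bcirc1l : left_id bone bcirc;
  bcirc1r : right_id bone bcirc;
  bcircVl : left_inverse bone binv bcirc;
  bcircVr : right_inverse bone binv bcirc;
  bcircD : forall a b c,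
    bcirc a (badd b c) = badd (badd (bcirc a b) (bopp a)) (bcirc a c)
}.

Definition blambda (B : Type) (L : left_brace B) (a b : B) : B :=
  badd L (bopp L a) (bcirc L a b).

Section PermutationBrace.
Variables (X : finType) (S : solution X).

Definition sigma (x : X) : {perm X} := perm (bij_inj (sol_sigma_bij S x)).

Definition perm_group : {group {perm X}} := <<[set sigma x | x : X]>>%G.

Lemma sigma_in_perm_group x : sigma x \in perm_group.
Proof. by apply/mem_gen/imset_f. Qed.

Definition sigma_sub (x : X) : [subg perm_group] :=
  Subg (sigma_in_perm_group x).

(* Multiplication in {perm X} is composition in reversed order,
   (s * t) x = t (s x), whereas the circle operation of the brace is genuine
   composition of functions; hence it is specified pointwise. *)
Record is_permutation_brace (L : left_brace [subg perm_group]) : Prop := {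
  pb_circ : forall (a b : [subg perm_group]) (x : X),
    sgval (bcirc L a b) x = sgval a (sgval b x);
  pb_lambda : forall (g : [subg perm_group]) (x : X),
    blambda L g (sigma_sub x) = sigma_sub (sgval g x)
}.

Definition dot (x y : X) : X := (sigma x)^-1%g y.

(* [Omega m] is the operation of arity m.+1: the two recursive calls drop the
   last and the last but one argument respectively. *)
Fixpoint Omega (m : nat) : ('I_m.+1 -> X) -> X :=
  match m with
  | 0 => fun t => t ord0
  | k.+1 => fun t =>
      dot (Omega (fun i : 'I_k.+1 => t (lift ord_max i)))
          (Omega (fun i : 'I_k.+1 => t (lift (lift ord_max ord_max) i)))
  end.

Definition Omega_trivial (d : nat) : Prop :=
  forall x y : X, Omega (fun i : 'I_d.+1 => if i == ord_max then y else x) = y.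

Definition is_Dehornoy_class (d : nat) : Prop :=
  [/\ 0 < d, Omega_trivial d &
      forall e, 0 < e -> Omega_trivial e -> d <= e].

End PermutationBrace.

Definition max_perm_order (n : nat) : nat := \max_(s : 'S_n) #[s]%g.

(* Main.v *)
From HB Require Import structures.
Require Import Defs.
From mathcomp Require Import all_boot all_fingroup.
From mathcomp Require Import cyclic nilpotent abelian zify.

(** The hypothesis turns two different notions of order into one.

    For [x] in [X] put [T x = x . x], so that [sigma x] sends [T x] to [x].
    Applying [lambda] at [sigma x] to [sigma (T x)] therefore gives [sigma x],
    and by hypothesis [lambda] at [sigma x] fixes [sigma x]; as it is injective,
    [sigma (T x) = sigma x] ([sigma_dot_diag]).  The successive left factors in
    the recursive definition of [Omega] at [(x, ..., x, y)] are the iterates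
    [T^i x], which all have the same [sigma]; so the value is
    [sigma x ^- d] at [y] ([Omega_last]), and the identity defining the
    Dehornoy class holds at [d] exactly when [sigma x ^+ d = 1] for all [x].

    It remains to find one permutation whose order is a multiple of the order
    of every [sigma x].  A non-abelian group need not contain an element
    whose order is a multiple of all the others.  But
    [lambda_a(a) = a] says that the circle powers of [a] are its additive
    multiples ([bcirc_additive_expg], [sgval_additive_expg]), so orders may be
    computed in the additive group of the brace.  That group is finite abelian,
    and therefore has an element whose order is the exponent of the group.  As
    a permutation of [X], this element has order at most [g(n)], and its order
    annihilates all the [sigma x]. *)

Set Implicit Arguments.
Unset Strict Implicit.
Unset Printing Implicit Defensive.

Local Open Scope group_scope.

(** A copy of the carrier, so that the addition can be declared as a group law
    on a type which already carries another one; powers in this group are the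
    additive multiples. *)
Definition additive (B : finType) (L : left_brace B) : Type := B.

HB.instance Definition _ (B : finType) (L : left_brace B) :=
  Finite.on (additive L).
HB.instance Definition _ (B : finType) (L : left_brace B) :=
  Finite_isGroup.Build (additive L) (@baddA B L) (@badd0 B L) (@baddN B L).

Section FiniteBrace.
Variables (B : finType) (L : left_brace B).
Implicit Types a b c : additive L.

Lemma additive_abelian : abelian [set: additive L].
Proof. by apply/centsP => a _ b _; apply: baddC. Qed.

Local Notation lambda a b := (blambda L a (b : additive L) : additive L).

Lemma bcirc_blambda a b : bcirc L a b = a * lambda a b :> additive L.
Proof. exact/esym/(mulKVg (a : additive L)). Qed.

Lemma blambdaD a b c : lambda a (b * c) = lambda a b * lambda a c.
Proof.
apply: (mulgI a); rewrite [RHS]mulgA -!bcirc_blambda.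
by apply: etrans (bcircD L a b c) _; rewrite [RHS]/mulg /= /blambda baddA.
Qed.

Lemma blambda0 a : lambda a 1 = 1.
Proof. by apply: (mulgI (lambda a 1)); rewrite -blambdaD !mulg1. Qed.

Lemma blambdaX a b k : lambda a (b ^+ k) = lambda a b ^+ k.
Proof. by elim: k => [|k IH]; rewrite ?blambda0 // !expgS blambdaD IH. Qed.

Lemma blambda_inj a : injective (blambda L a).
Proof.
move=> b c /(congr1 (mulg a)); rewrite -!bcirc_blambda.
by move/(congr1 (bcirc L (binv L a))); rewrite !bcircA bcircVl !bcirc1l.
Qed.

Lemma bone_bzero : bone L = 1 :> additive L.
Proof. by rewrite -[RHS](bcirc1l L) bcirc_blambda blambda0 mulg1. Qed.

(** An additive multiple of [a] is fixed by [lambda_a] as soon as [a] is, so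
    circling it by [a] merely adds [a]. *)
Lemma bcirc_additive_expg a k :
  lambda a a = a -> bcirc L a (a ^+ k) = a ^+ k.+1.
Proof. by move=> lam_a; rewrite bcirc_blambda blambdaX lam_a expgS. Qed.

End FiniteBrace.

Section PermutationBrace.
Variables (X : finType) (S : solution X).
Variables (B : left_brace [subg (perm_group S)]) (hB : is_permutation_brace B).
Hypothesis lambda_diag : forall a, blambda B a a = a.

Lemma sgval_additive_expg (a : [subg (perm_group S)]) k :
  sgval ((a : additive B) ^+ k) = sgval a ^+ k.
Proof.
elim: k => [|k IH]; apply/permP => x.
  (* The neutral element of the circle is an idempotent permutation. *)
  rewrite !expg0 perm1 -bone_bzero; apply: (@perm_inj _ (sgval (bone B))).
  by rewrite -(pb_circ hB) bcirc1l.
by rewrite -bcirc_additive_expg // (pb_circ hB) IH expgSr permM.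
Qed.

(** In a finite abelian group the exponent is the order of some element; this
    applies to the additive group, and orders are the same there as in the
    permutation group. *)
Lemma exists_exponent_perm :
  exists s : {perm X}, forall x, sigma S x ^+ #[s] = 1.
Proof.
have [b _ expb] := exponent_witness (abelian_nil (additive_abelian B)).
exists (sgval b) => x.
have expg_b : (b : additive B) ^+ #[sgval b] = 1.
  apply: (@subg_inj _ (perm_group S)); rewrite sgval_additive_expg expg_order.
  by rewrite -[1 in RHS](expg0 b) sgval_additive_expg.
have /dvdnP[q ->] : exponent [set: additive B] %| #[sgval b].
  by rewrite expb order_dvdn expg_b.
rewrite -[sigma S x]/(sgval (sigma_sub S x)) -sgval_additive_expg mulnC expgM.
rewrite expg_exponent ?inE // expg1n.
by rewrite -[1 in LHS](expg0 b) sgval_additive_expg.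
Qed.

(** Both [sigma (x . x)] and [sigma x] are sent to [sigma x] by [lambda] at
    [sigma x], the former because [sigma x] maps [x . x] to [x]. *)
Lemma sigma_dot_diag x : sigma S (dot S x x) = sigma S x.
Proof.
suff /(congr1 sgval) : sigma_sub S (dot S x x) = sigma_sub S x by [].
by apply: (@blambda_inj _ B (sigma_sub S x)); rewrite lambda_diag (pb_lambda hB) /dot permKV.
Qed.

Lemma eq_Omega m (t u : 'I_m.+1 -> X) : t =1 u -> Omega S t = Omega S u.
Proof.
elim: m t u => [|m IH] t u tu /=; first exact: tu.
by congr (dot S _ _); apply: IH => i; apply: tu.
Qed.

Lemma sigma_Omega_const m x :
  sigma S (Omega S (fun _ : 'I_m.+1 => x)) = sigma S x.
Proof. by elim: m => //= m IH; rewrite sigma_dot_diag. Qed.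

(** Every step of the recursion applies one more [(sigma z)^-1], with [z] the
    value of [Omega] at a constant tuple [(x, ..., x)], and [sigma z] is always
    [sigma x]. *)
Lemma Omega_last m x y :
  Omega S (fun i : 'I_m.+1 => if i == ord_max then y else x)
    = (sigma S x ^- m) y.
Proof.
elim: m => [|m IH]; first by rewrite /= expg0 invg1 perm1.
rewrite [LHS]/= /dot.
have ->: Omega S (fun i : 'I_m.+1 =>
    if lift ord_max i == ord_max then y else x)
  = Omega S (fun _ : 'I_m.+1 => x).
  by apply: eq_Omega => i; rewrite eq_sym (negPf (neq_lift _ _)).
rewrite sigma_Omega_const expgS invMg permM -IH; congr (_ _).
apply: eq_Omega => i; congr (if _ then _ else _).
(* Skipping the last but one position keeps the last position last. *)
rewrite -!val_eqE /= /bump; have := ltn_ord i; lia.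
Qed.

End PermutationBrace.

(** Numbering the points of [T] conjugates [s] into a permutation of the
    ordinals below [#|T|] of the same order. *)
Lemma order_leq_max_perm_order (T : finType) (s : {perm T}) :
  #[s] <= max_perm_order #|T|.
Proof.
pose f (i : 'I_#|T|) := enum_rank (s (enum_val i)).
have f_inj : injective f by move=> i j /enum_rank_inj/perm_inj/enum_val_inj.
pose s' : 'S_#|T| := perm f_inj.
have s'X k x : (s' ^+ k) (enum_rank x) = enum_rank ((s ^+ k) x).
  elim: k => [|k IH]; first by rewrite !perm1.
  by rewrite !expgSr !permM IH permE /f enum_rankK.
apply: leq_trans (leq_bigmax s'); apply: dvdn_leq => //.
rewrite order_dvdn; apply/eqP/permP => x; apply: enum_rank_inj.
by rewrite -s'X expg_order !perm1.
Qed.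

Theorem proposition5p9 (X : finType) (n : nat) (S : solution X)
    (cardX : #|X| = n)
    (B : left_brace [subg (perm_group S)])
    (hB : is_permutation_brace B)
    (hlambda : forall a : [subg (perm_group S)], blambda B a a = a) :
  exists2 d : nat, is_Dehornoy_class S d & d <= max_perm_order n.
Proof.
have [s sigma_s] := exists_exponent_perm hB hlambda.
pose P d := (0 < d) && [forall x, forall y, (sigma S x ^- d) y == y].
have trivP d : reflect (Omega_trivial S d)
                       [forall x, forall y, (sigma S x ^- d) y == y].
  apply: (iffP forallP) => [triv x y | triv x].
    by rewrite (Omega_last hB hlambda); apply/eqP/(forallP (triv x)).
  by apply/forallP => y; rewrite -(Omega_last hB hlambda) triv.
have Ps : P #[s].
  rewrite /P order_gt0; apply/forallP => x; apply/forallP => y.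
  by rewrite sigma_s invg1 perm1.
case: (ex_minnP (ex_intro P _ Ps)) => d /andP[d_gt0 /trivP triv_d] min_d.
exists d.
  by split=> // e e_gt0 /trivP triv_e; apply: min_d; rewrite /P e_gt0.
by rewrite -cardX; apply: leq_trans (min_d _ Ps) (order_leq_max_perm_order s).
Qed.
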